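(* Let $m,n$ be positive integers. Then: (i) $\bigcup_{\boldsymbol{\gamma}\in[0,1)^{m}}\Omega^{\boldsymbol{\gamma}}(m,n)=[0,1)^{m\times n}\setminus\mathbf{Bad}^{\boldsymbol{0}}(m,n)$; equivalently, for $A\in[0,1)^{m\times n}$, $\Omega_A(m,n)=\emptyset$ if and only if $A\in\mathbf{Bad}^{\boldsymbol{0}}(m,n)$. (ii) For every $\boldsymbol{\gamma}\in[0,1)^{m}$, $\mu_{mn}(\Omega^{\boldsymbol{\gamma}}(m,n))=0$. (iii) For every $A\in[0,1)^{m\times n}$, $\mu_{m}(\Omega_{A}(m,n))=0$.
   Context: $[0,1)^{m\times n}$ is the set of real $m\times n$ matrices with entries in $[0,1)$. For $\boldsymbol{x}\in\mathbb{R}^n$, $\|\boldsymbol{x}\|=\max_i|x_i|$; for $\boldsymbol{y}\in\mathbb{R}^m$, $\langle\boldsymbol{y}\rangle=\min_{\boldsymbol{p}\in\mathbb{Z}^m}\|\boldsymbol{y}-\boldsymbol{p}\|$. For $\psi:\mathbb{N}\to[0,\infty)$, $W_{m,n}(\psi)$ is the set of pairs $(A,\boldsymbol{\gamma})\in[0,1)^{m\times n}\times[0,1)^m$ such that $\langle A\boldsymbol{q}-\boldsymbol{\gamma}\rangle<\psi(\|\boldsymbol{q}\|)$ for infinitely many $\boldsymbol{q}\in\mathbb{Z}^n$. ''Decreasing'' means non-increasing. $\mathcal{D}$ is the set of decreasing $\psi:\mathbb{N}\to[0,\infty)$ with $\sum_{q\ge1}q^{n-1}\psi(q)^m=\infty$.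 $\Omega(m,n)=\bigcap_{\psi\in\mathcal{D}}W_{m,n}(\psi)$, $\Omega^{\boldsymbol{\gamma}}(m,n)=\{A:(A,\boldsymbol{\gamma})\in\Omega(m,n)\}$, $\Omega_A(m,n)=\{\boldsymbol{\gamma}\in[0,1)^m:(A,\boldsymbol{\gamma})\in\Omega(m,n)\}$. $\mathbf{Bad}^{\boldsymbol{0}}(m,n)=\{A\in[0,1)^{m\times n}:\liminf_{\boldsymbol{q}\in\mathbb{Z}^n,\|\boldsymbol{q}\|\to\infty}\|\boldsymbol{q}\|^n\langle A\boldsymbol{q}\rangle^m>0\}$. $\mu_l$ denotes $l$-dimensional Lebesgue measure. *)

(* Defs.v *)
From HB Require Import structures.
From mathcomp Require Import all_boot all_order all_algebra.
From mathcomp Require Import all_classical all_reals all_analysis.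
Unset Printing Implicit Defensive.
Import Order.TTheory GRing.Theory Num.Theory Num.Def.
Local Open Scope classical_set_scope.
Local Open Scope ring_scope.

Section Defs.
Context {R : realType}.

Definition unit_cube (p q : nat) : set 'M[R]_(p, q) :=
  [set A | forall i j, 0 <= A i j /\ A i j < 1].

Definition supnormZ (n : nat) (q : 'cV[int]_n) : nat := \max_(i < n) `|q i ord0|%N.

(* <y> = min_{p in Z^m} ||y - p||  (written as an infimum; it is attained) *)
Definition distZ (m : nat) (y : 'cV[R]_m) : R :=
  inf [set d | exists p : 'cV[int]_m,
         d = \big[maxr/0]_(i < m) `|y i ord0 - (p i ord0)%:~R|].

Definition W (m n : nat) (psi : nat -> R) : set ('M[R]_(m, n) * 'cV[R]_m) :=
  [set Ag | unit_cube m n Ag.1 /\ unit_cube m 1 Ag.2 /\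
     infinite_set [set q : 'cV[int]_n |
        distZ m (Ag.1 *m map_mx (fun z : int => z%:~R) q - Ag.2) < psi (supnormZ n q)]].

Definition classD (m n : nat) (psi : nat -> R) : Prop :=
  (forall k, 0 <= psi k) /\
  (forall i j, (1 <= i <= j)%N -> psi j <= psi i) /\
  ((fun N : nat => \sum_(1 <= q < N) (q%:R ^+ (n - 1) * psi q ^+ m)) @ \oo --> +oo).

Definition Omega (m n : nat) : set ('M[R]_(m, n) * 'cV[R]_m) :=
  [set Ag | forall psi, classD m n psi -> W m n psi Ag].

Definition Omega_up (m n : nat) (g : 'cV[R]_m) : set 'M[R]_(m, n) :=
  [set A | Omega m n (A, g)].

Definition Omega_low (m n : nat) (A : 'M[R]_(m, n)) : set 'cV[R]_m :=
  [set g | Omega m n (A, g)].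

(* Bad^0(m,n): liminf_{||q||->oo} ||q||^n <Aq>^m > 0, i.e. there are c > 0 and N
   with ||q||^n <Aq>^m >= c whenever ||q|| >= N *)
Definition Bad0 (m n : nat) : set 'M[R]_(m, n) :=
  [set A | unit_cube m n A /\ exists c : R, 0 < c /\ exists N : nat,
     forall q : 'cV[int]_n, (N <= supnormZ n q)%N ->
       c <= (supnormZ n q)%:R ^+ n * distZ m (A *m map_mx (fun z : int => z%:~R) q) ^+ m].

Definition box (p q : nat) (a b : 'M[R]_(p, q)) : set 'M[R]_(p, q) :=
  [set x | forall i j, a i j <= x i j <= b i j].

Definition lebesgue_null (p q : nat) (S : set 'M[R]_(p, q)) : Prop :=
  forall eps : R, 0 < eps ->
  exists a b : nat -> 'M[R]_(p, q),
    (forall k i j, a k i j <= b k i j) /\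
    S `<=` \bigcup_k box p q (a k) (b k) /\
    (forall N, \sum_(k < N) \prod_(i < p) \prod_(j < q) (b k i j - a k i j) <= eps).

End Defs.

(* Main.v *)
(** A nonincreasing [psi] lies in [D] as soon as [Q^n psi(Q)^m] does not tend to [0], since one
    dyadic block then contributes a fixed amount to the series.

    Part (i). If [A] is badly approximable, the points [A q] with [|q| <= Q] are separated by
    [Q^(-n/m)], so [psi(Q) = min <A q - g>] over [|q| <= Q] (leaving out the at most one [q] with
    [<A q - g> = 0]) cannot satisfy [Q^n psi(Q)^m -> 0]: consecutive minimizers would coincide.
    This [psi] is in [D] and excludes [(A, g)].  If [A] is not badly approximable, take sparse
    [r_k] with [|r_k|^n <A r_k>^m <= 2^(-mk)] and let [g] be the sum of the [A r_k] modulo 1;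
    for [q_k = r_1 + ... + r_k], an inequality [psi(|q_k|) <= <A q_k - g>] for all large [k] would
    make the series of [psi] converge.

    Part (ii). For fixed [g], the same minimum function [psi_A] shows that [A] is in the fiber only
    if the condensed series of the [X_k = 2^(kn) psi_A(2^k)^m] converges.  As
    [X_k < c] has measure [O(c)], Markov's inequality shows that a set where the partial sums
    stay below a fixed [M] is null.  The measure is computed by counting points of a grid of
    prime mesh, on which a nonzero linear form is equidistributed.

    Part (iii). If [A] is not badly approximable, choose [r] with [<A r>] tiny and [Q = L |r|]:
    reducing [q] modulo [r], the points [A q] with [|q| <= Q] concentrate near few points, so that
    their [Q^(-n/m)]-neighbourhood has measure [O(1/L)].  A step function along such [Q]'s is
    in [D]. *)
Require Import Defs.
From HB Require Import structures.
From mathcomp Require Import all_boot all_order all_algebra.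
From mathcomp Require Import all_classical all_reals all_analysis.
From mathcomp Require Import ring lra zify.
Import Order.TTheory GRing.Theory Num.Theory Num.Def.
Import numFieldNormedType.Exports.
Local Open Scope classical_set_scope.
Local Open Scope ring_scope.

Local Notation intmx q := (map_mx (fun z : int => z%:~R) q).

(** * Calculus of the distance to the nearest integer vector *)

Section Distance.
Context {R : realType} {m : nat}.
Implicit Types (y z : 'cV[R]_m) (d e : R).

Let dists y := [set d : R | exists p : 'cV[int]_m,
  d = \big[maxr/0]_(i < m) `|y i ord0 - (p i ord0)%:~R|].

Let has_inf_dists y : has_inf (dists y).
Proof.
split; first by exists (\big[maxr/0]_(i < m) `|y i ord0 - ((0 : 'cV[int]_m) i ord0)%:~R|), 0.
by exists 0 => _ [p ->]; apply: bigmax_ge_id.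
Qed.

Lemma distZ_ge0 y : 0 <= distZ m y.
Proof.
by apply: lb_le_inf; [case: (has_inf_dists y) | move=> _ [p ->]; apply: bigmax_ge_id].
Qed.

(** A strict bound on the infimum already yields a witness [p], which stands in for attainment of
    the minimum; [0 < d] covers the default [0] of the maximum. *)
Lemma distZ_ltP y d : 0 < d ->
  distZ m y < d <-> exists p : 'cV[int]_m, forall i, `|y i ord0 - (p i ord0)%:~R| < d.
Proof.
move=> d0; split.
  case/(inf_lt (proj1 (has_inf_dists y))) => _ [p ->] /bigmax_ltP [_ h].
  by exists p => i; apply: h.
move=> [p h]; apply: (@le_lt_trans _ _ (\big[maxr/0]_(i < m) `|y i ord0 - (p i ord0)%:~R|)).
  by apply: ge_inf; [case: (has_inf_dists y) | exists p].
by apply/bigmax_ltP; split=> // i _; apply: h.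
Qed.

Lemma distZ_le y (p : 'cV[int]_m) d : 0 <= d ->
  (forall i, `|y i ord0 - (p i ord0)%:~R| <= d) -> distZ m y <= d.
Proof.
move=> d0 h; apply/ler_addgt0Pr => e e0; apply/ltW/distZ_ltP; first by lra.
by exists p => i; have := h i; lra.
Qed.

Lemma distZD y z : distZ m (y + z) <= distZ m y + distZ m z.
Proof.
apply/ler_addgt0Pr => e e0; apply/ltW.
have y0 := distZ_ge0 y; have z0 := distZ_ge0 z.
have /distZ_ltP[|p hp] : distZ m y < distZ m y + e / 2 by lra.
  by lra.
have /distZ_ltP[|s hs] : distZ m z < distZ m z + e / 2 by lra.
  by lra.
apply/distZ_ltP; first by lra.
exists (p + s) => i; rewrite !mxE intrD.
have := hp i; have := hs i.
have := ler_normD (y i ord0 - (p i ord0)%:~R) (z i ord0 - (s i ord0)%:~R).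
have -> : y i ord0 + z i ord0 - ((p i ord0)%:~R + (s i ord0)%:~R) =
  (y i ord0 - (p i ord0)%:~R) + (z i ord0 - (s i ord0)%:~R) by ring.
by lra.
Qed.

Lemma distZN y : distZ m (- y) = distZ m y.
Proof.
suff h z : distZ m (- z) <= distZ m z.
  by apply/eqP; rewrite eq_le h -{1}(opprK y) h.
apply/ler_addgt0Pr => e e0; apply/ltW.
have z0 := distZ_ge0 z.
have /distZ_ltP[|p hp] : distZ m z < distZ m z + e by lra.
  by lra.
apply/distZ_ltP; first by lra.
by exists (- p) => i; rewrite !mxE intrN -opprD normrN.
Qed.

Lemma distZB y z : distZ m (y - z) <= distZ m y + distZ m z.
Proof. by rewrite -(distZN z); exact: distZD. Qed.

Lemma distZ0 : distZ m (0 : 'cV[R]_m) = 0.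
Proof.
apply/eqP; rewrite eq_le distZ_ge0 andbT.
by apply: (distZ_le _ 0) => // i; rewrite !mxE subrr normr0.
Qed.

Lemma distZMn y k : distZ m (y *+ k) <= k%:R * distZ m y.
Proof.
elim: k => [|k IH]; first by rewrite mulr0n distZ0 mul0r.
rewrite mulrS; apply: le_trans (distZD _ _) _.
by rewrite -natr1 mulrDl mul1r addrC lerD2r.
Qed.

Lemma distZMz y (k : int) : distZ m (y *~ k) <= `|k|%:R * distZ m y.
Proof.
by case: k => k; rewrite /intmul ?distZN; exact: distZMn.
Qed.

End Distance.

(** * Integer vectors and their sup norm *)

Lemma intmxD {R : realType} {n : nat} (p q : 'cV[int]_n) :
  intmx (p + q) = intmx p + intmx q :> 'cV[R]_n.
Proof. by apply/matrixP=> i j; rewrite !mxE intrD. Qed.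

Lemma intmxB {R : realType} {n : nat} (p q : 'cV[int]_n) :
  intmx (p - q) = intmx p - intmx q :> 'cV[R]_n.
Proof. by apply/matrixP=> i j; rewrite !mxE intrD intrN. Qed.

Lemma intmxMz {R : realType} {n : nat} (p : 'cV[int]_n) (k : int) :
  intmx (k *: p) = (k%:~R) *: intmx p :> 'cV[R]_n.
Proof. by apply/matrixP=> i j; rewrite !mxE intrM. Qed.

Section Supnorm.
Context {n : nat}.
Implicit Types p q : 'cV[int]_n.

Lemma supnormZ_leP q N :
  reflect (forall i, (`|q i ord0| <= N)%N) (supnormZ n q <= N)%N.
Proof.
by rewrite /supnormZ; apply: (iffP (bigmax_leqP _ _ _)) => h i => [|_]; apply: h.
Qed.

Lemma supnormZ_ge q i : (`|q i ord0| <= supnormZ n q)%N.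
Proof. by move: i; apply/supnormZ_leP. Qed.

Lemma supnormZD p q : (supnormZ n (p + q) <= supnormZ n p + supnormZ n q)%N.
Proof.
have absD (a b : int) : (`|(a + b)%R| <= `|a| + `|b|)%N by lia.
apply/supnormZ_leP => i; rewrite mxE; apply: leq_trans (absD _ _) _.
by apply: leq_add; exact: supnormZ_ge.
Qed.

Lemma supnormZN q : supnormZ n (- q) = supnormZ n q.
Proof. by apply: eq_bigr => i _; rewrite mxE abszN. Qed.

Lemma supnormZB p q : (supnormZ n (p - q) <= supnormZ n p + supnormZ n q)%N.
Proof. by rewrite -(supnormZN q) supnormZD. Qed.

Lemma supnormZ_eq0 q : (supnormZ n q == 0)%N = (q == 0).
Proof.
apply/eqP/eqP => [h|->].
  apply/matrixP => i j; rewrite ord1 mxE; apply/eqP; rewrite -absz_eq0 -leqn0.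
  by rewrite (leq_trans (supnormZ_ge q i))// h.
by apply: big1 => i _; rewrite mxE.
Qed.

Lemma supnormZ_scale q (k : nat) : supnormZ n (k%:Z *: q) = (k * supnormZ n q)%N.
Proof.
rewrite /supnormZ (big_endo (fun x => k * x)%N); first last.
- by rewrite muln0.
- by move=> x y; rewrite maxnMr.
by apply: eq_bigr => i _; rewrite mxE abszM.
Qed.

End Supnorm.

Lemma supnormZ_attained {n : nat} (q : 'cV[int]_n.+1) :
  exists i, supnormZ n.+1 q = `|q i ord0|%N.
Proof.
by have [|i h] := @bigop.eq_bigmax 'I_n.+1 (fun i => `|q i ord0|%N) _; [rewrite card_ord | exists i].
Qed.

Lemma root_exists {R : realType} (m : nat) (x : R) : (0 < m)%N -> 0 < x ->
  exists d, 0 < d /\ d ^+ m = x.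
Proof.
move=> m0 x0; exists (x `^ m%:R^-1); split; first exact: powR_gt0.
by rewrite -powR_mulrn ?powR_ge0// -powRrM mulVf ?pnatr_eq0 -?lt0n// powRr1// ltW.
Qed.

(** * Cauchy condensation for non-increasing [psi] *)

Section Divergence.
Context {R : realType} {m n : nat} (hn : (0 < n)%N).
Variable psi : nat -> R.
Hypothesis psi_ge0 : forall k, 0 <= psi k.
Hypothesis psi_mono : forall i j, (1 <= i <= j)%N -> psi j <= psi i.

Let term q := q%:R ^+ (n - 1) * psi q ^+ m.
Let psum N := \sum_(1 <= q < N) term q.

Let term_ge0 q : 0 <= term q.
Proof. by rewrite mulr_ge0 ?exprn_ge0. Qed.

Let psum_le N N' : (N <= N')%N -> psum N <= psum N'.
Proof.
move=> NN'; case: N NN' => [|N] NN'.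
  by rewrite /psum big_geq// sumr_ge0.
by rewrite /psum (@big_cat_nat _ _ _ N.+1 1 N')//= lerDl sumr_ge0.
Qed.

Lemma not_classD_bounded : ~ classD m n psi -> exists M, forall N, psum N <= M.
Proof.
move=> h; apply: contrapT => hM; apply: h; split=> //; split=> //.
apply/cvgryPge => A.
have [N hN] : exists N, A < psum N.
  apply: contrapT => hN; apply: hM; exists A => N.
  by rewrite leNgt; apply/negP => hA; apply: hN; exists N.
by exists N => // N' /= NN'; apply: le_trans (ltW hN) _; exact: psum_le.
Qed.

Let dyadic k := (2 ^ k.+1)%:R ^+ n * psi (2 ^ k.+1) ^+ m.

Let dyadic_ge0 k : 0 <= dyadic k.
Proof. by rewrite mulr_ge0 ?exprn_ge0. Qed.

(** The block [(2^K, 2^(K+1)]] has [2^K] terms, each at least [(2^K)^(n-1) psi(2^(K+1))^m]; the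
    factor [2^n] turns [(2^K)^n] into [(2^(K+1))^n]. *)
Let condensation K : \sum_(0 <= k < K) dyadic k <= 2 ^+ n * psum (2 ^ K).+1.
Proof.
elim: K => [|K IH].
  by rewrite big_geq// mulr_ge0 ?exprn_ge0// /psum sumr_ge0.
rewrite big_nat_recr//= /psum (@big_cat_nat _ _ _ (2 ^ K).+1 1)//=; last first.
  by rewrite ltnS leq_exp2l.
rewrite mulrDr lerD//.
have -> : dyadic K = 2 ^+ n *
    \sum_((2 ^ K).+1 <= q < (2 ^ K.+1).+1) ((2 ^ K)%:R ^+ (n - 1) * psi (2 ^ K.+1) ^+ m).
  rewrite sumr_const_nat subSS expnS mul2n -addnn addnK addnn -mul2n -expnS /dyadic.
  rewrite -[_ *+ (2 ^ K)]mulr_natl [X in 2 ^+ n * X]mulrA -exprS subn1 prednK// mulrA.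
  by rewrite -exprMn -natrM -expnS.
rewrite ler_pM2l ?exprn_gt0//; apply: ler_sum_nat => q /andP[q1 q2].
apply: ler_pM; rewrite ?exprn_ge0//.
  by rewrite lerXn2r ?nnegrE// ler_nat ltnW.
rewrite lerXn2r ?nnegrE//; apply: psi_mono.
by apply/andP; split; [exact: leq_ltn_trans q1 | exact: q2].
Qed.

Lemma not_classD_dyadic_bounded : ~ classD m n psi ->
  exists M, forall K, \sum_(0 <= k < K) dyadic k <= M.
Proof.
move=> /not_classD_bounded[M hM]; exists (2 ^+ n * M) => K.
by apply: le_trans (condensation K) _; rewrite ler_pM2l ?exprn_gt0.
Qed.

Lemma not_classD_dyadic_small (c : R) : ~ classD m n psi -> 0 < c ->
  exists K, forall k, (K <= k)%N -> dyadic k < c.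
Proof.
move=> /not_classD_dyadic_bounded[M hM] c0.
have : cvgn (series dyadic).
  apply: nondecreasing_is_cvgn.
    apply/nondecreasing_seqP => k; rewrite /series/= big_nat_recr//= lerDl.
    exact: dyadic_ge0.
  by exists M => _ [k _ <-]; exact: hM.
move/cvg_series_cvg_0/cvgr0_norm_lt => /(_ _ c0)[K _ hK].
by exists K => k Kk; have := hK k Kk; rewrite /= ger0_norm.
Qed.

(** For [2^t <= Q < 2^(t+1)], monotonicity gives [Q^n psi(Q)^m <= 2^n (2^t)^n psi(2^t)^m], so the
    dyadic bound is applied with [c / 2^n]. *)
Lemma not_classD_small (c : R) : ~ classD m n psi -> 0 < c ->
  exists K, forall Q, (K <= Q)%N -> Q%:R ^+ n * psi Q ^+ m < c.
Proof.
move=> hD c0; have c1 : 0 < c / 2 ^+ n by rewrite divr_gt0 ?exprn_gt0.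
have [K hK] := not_classD_dyadic_small _ hD c1.
exists (2 ^ K.+1)%N => Q KQ.
have Q0 : (0 < Q)%N by rewrite (leq_trans _ KQ) ?expn_gt0.
have := trunc_log_bounds (isT : (1 < 2)%N) Q0; set t := trunc_log 2 Q => /= /andP[tQ Qt].
have Kt : (K < t)%N by rewrite -ltnS -(@ltn_exp2l 2)// (leq_ltn_trans KQ Qt).
have := hK t.-1; rewrite -ltnS (ltn_predK Kt) => /(_ Kt).
rewrite /dyadic (ltn_predK Kt) ltr_pdivlMr ?exprn_gt0//; apply: le_lt_trans.
rewrite mulrAC; apply: ler_pM; rewrite ?exprn_ge0//.
  by rewrite -exprMn -natrM -expnSr lerXn2r ?nnegrE// ler_nat ltnW.
by rewrite lerXn2r ?nnegrE//; apply: psi_mono; rewrite expn_gt0.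
Qed.

(** The terms with [T k <= q < T k.+1] sum to at most [(T k.+1)^n psi(T k)^m], so a geometric series
    dominates. *)
Lemma geometric_not_classD (T : nat -> nat) (C : R) :
  (forall k, (0 < T k < T k.+1)%N) ->
  (forall k, (T k.+1)%:R ^+ n * psi (T k) ^+ m <= C / 2 ^+ k) -> ~ classD m n psi.
Proof.
move=> hT hC [_ [_ /cvgryPge hD]].
have C0 : 0 <= C.
  by have := hC 0; rewrite expr0 divr1; apply: le_trans; rewrite mulr_ge0 ?exprn_ge0.
(* [2 C (1 - 2^-k)] is the exact sum of [C / 2^j] over [j < k], which lets the induction close. *)
have step k : psum (T k) <= psum (T 0) + 2 * C * (1 - (2 ^+ k)^-1).
  elim: k => [|k IH]; first by rewrite expr0 invr1 subrr mulr0 addr0.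
  have /andP[Tk0 Tk] := hT k.
  rewrite {1}/psum (@big_cat_nat _ _ _ (T k))//=; last exact: ltnW.
  have : \sum_(T k <= q < T k.+1) term q <= C / 2 ^+ k.
    apply: le_trans (hC k).
    apply: (@le_trans _ _ (\sum_(T k <= q < T k.+1) ((T k.+1)%:R ^+ (n - 1) * psi (T k) ^+ m))).
      apply: ler_sum_nat => q /andP[q1 q2]; apply: ler_pM; rewrite ?exprn_ge0//.
        by rewrite lerXn2r ?nnegrE// ler_nat ltnW.
      by rewrite lerXn2r ?nnegrE//; apply: psi_mono; rewrite Tk0.
    rewrite sumr_const_nat -[X in X <= _]mulr_natl mulrA ler_wpM2r ?exprn_ge0//.
    apply: (@le_trans _ _ ((T k.+1)%:R * (T k.+1)%:R ^+ (n - 1))).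
      by rewrite ler_wpM2r ?exprn_ge0// ler_nat leq_subr.
    by rewrite -exprS subn1 prednK.
  move: IH; rewrite exprS invfM /psum.
  set a := \sum_(_ <= _ < T k) _; set b := \sum_(_ <= _ < T k.+1) _.
  set e := \sum_(_ <= _ < T 0) _; set u := (2 ^+ k)^-1.
  by move=> h1 h2; have -> : 2 * C * (1 - 2^-1 * u) = 2 * C * (1 - u) + C * u; [field|lra].
have Tge k : (k <= T k)%N.
  by elim: k => // k IH; have /andP[_] := hT k; apply: leq_ltn_trans.
have [N _ hN] := hD (psum (T 0) + 2 * C + 1).
have := hN (T N) (Tge N); have := step N.
have : 0 <= C * (2 ^+ N)^-1 by rewrite mulr_ge0 ?invr_ge0 ?exprn_ge0.
rewrite /= -/(psum (T N)); lra.
Qed.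

End Divergence.

(** * The minimum function of an inhomogeneous form *)

Section InhomogeneousMinimum.
Context {R : realType} {m n : nat}.
Variables (A : 'M[R]_(m, n)) (g : 'cV[R]_m) (P : set 'cV[int]_n).

(** The value [1] keeps the set nonempty when no vector of [P] is short enough. [P] serves to
    discard finitely many [q]: a possible exact solution in one use, [0] in the other. *)
Definition inhom_min (Q : nat) : R :=
  inf [set x | x = 1 \/ exists q, [/\ P q, (supnormZ n q <= Q)%N & x = distZ m (A *m intmx q - g)]].

Let lb0 Q : lbound [set x | x = 1 \/ exists q,
  [/\ P q, (supnormZ n q <= Q)%N & x = distZ m (A *m intmx q - g)]] 0.
Proof. by move=> _ [->//|[q [_ _ ->]]]; exact: distZ_ge0. Qed.

Lemma inhom_min_ge0 Q : 0 <= inhom_min Q.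
Proof. by apply: lb_le_inf; [exists 1; left | exact: lb0]. Qed.

Lemma inhom_min_le q Q : P q -> (supnormZ n q <= Q)%N ->
  inhom_min Q <= distZ m (A *m intmx q - g).
Proof. by move=> Pq qQ; apply: ge_inf; [exists 0; exact: lb0 | right; exists q]. Qed.

Lemma inhom_min_mono i j : (i <= j)%N -> inhom_min j <= inhom_min i.
Proof.
move=> ij; apply: lb_le_inf; first by exists 1; left.
move=> _ [->|[q [Pq qi ->]]]; last by apply: inhom_min_le => //; exact: leq_trans ij.
by apply: ge_inf; [exists 0; exact: lb0 | left].
Qed.

Lemma inhom_min_lt Q d : inhom_min Q < d -> d <= 1 ->
  exists q, [/\ P q, (supnormZ n q <= Q)%N & distZ m (A *m intmx q - g) < d].
Proof.
case/inf_lt; first by exists 1; left.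
move=> _ [->|[q [Pq qQ ->]]] h d1; last by exists q.
by move: (lt_le_trans h d1); rewrite ltxx.
Qed.

(** A vector [q] of [P] competes in the minimum at its own norm, so it cannot solve the strict
    inequality for [inhom_min]; all solutions lie in the finite complement of [P]. *)
Lemma inhom_min_not_classD : Omega m n (A, g) -> finite_set (~` P) ->
  ~ classD m n inhom_min.
Proof.
move=> hO fP /hO[_ [_ /=]]; apply; apply: sub_finite_set fP => q /= hq Pq.
by move: hq; rewrite ltNge inhom_min_le.
Qed.

End InhomogeneousMinimum.

(** * Badly approximable matrices: every target is excluded *)

Section BadlyApproximable.
Context {R : realType} {m n : nat} (hm : (0 < m)%N) (hn : (0 < n)%N).
Implicit Type A : 'M[R]_(m, n).

Lemma distZ_mulmx_scale A (q : 'cV[int]_n) (k : int) :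
  distZ m (A *m intmx (k *: q)) <= `|k|%:R * distZ m (A *m intmx q).
Proof. by rewrite intmxMz -scalemxAr scaler_int; exact: distZMz. Qed.

(** Multiplying a nonzero [q] by [N.+1] moves it past the threshold [N], while norm and distance
    grow by a factor of at most [N.+1]. *)
Lemma Bad0_lower_bound A : Bad0 m n A -> exists c : R, 0 < c /\
  forall q : 'cV[int]_n, q != 0 ->
    c <= (supnormZ n q)%:R ^+ n * distZ m (A *m intmx q) ^+ m.
Proof.
move=> [_ [c [c0 [N hN]]]].
have N0 : 0 < N.+1%:R :> R by rewrite ltr0n.
exists (c / (N.+1%:R ^+ n * N.+1%:R ^+ m)); split.
  by rewrite divr_gt0 ?mulr_gt0 ?exprn_gt0.
move=> q q0; rewrite ler_pdivrMr ?mulr_gt0 ?exprn_gt0//.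
have qpos : (0 < supnormZ n q)%N by rewrite lt0n supnormZ_eq0.
apply: le_trans (hN (N.+1%:Z *: q) _) _; rewrite supnormZ_scale.
  by rewrite (leq_trans (leqnSn N))// leq_pmulr.
rewrite natrM exprMn [leRHS](_ : _ = N.+1%:R ^+ n * (supnormZ n q)%:R ^+ n *
  (N.+1%:R * distZ m (A *m intmx q)) ^+ m); last by rewrite exprMn; ring.
rewrite ler_pM2l ?mulr_gt0 ?exprn_gt0 ?ltr0n//.
by rewrite lerXn2r ?nnegrE ?mulr_ge0 ?distZ_ge0//; exact: distZ_mulmx_scale.
Qed.

Lemma distZ_sub_inhom A (g : 'cV[R]_m) (p q : 'cV[int]_n) :
  distZ m (A *m intmx (p - q)) <= distZ m (A *m intmx p - g) + distZ m (A *m intmx q - g).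
Proof.
by apply: le_trans (distZB _ _); rewrite intmxB mulmxBr opprB addrA subrK.
Qed.

Lemma Bad0_Omega_empty A (g : 'cV[R]_m) : Bad0 m n A -> ~ Omega m n (A, g).
Proof.
move=> /Bad0_lower_bound[c [c0 hc]] hO.
pose dist q := distZ m (A *m intmx q - g).
have dist_ge0 q : 0 <= dist q by exact: distZ_ge0.
(* Two distinct exact solutions would differ by a nonzero vector at distance [0], against the lower
   bound. *)
have uniq0 q q' : dist q = 0 -> dist q' = 0 -> q = q'.
  move=> h h'; apply/eqP; rewrite -subr_eq0; apply/negP => /negP/hc.
  have -> : distZ m (A *m intmx (q - q')) = 0.
    apply/eqP; rewrite eq_le distZ_ge0 andbT.
    by apply: le_trans (distZ_sub_inhom _ g _ _) _; rewrite -/(dist _) h -/(dist _) h' addr0.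
  by rewrite expr0n eqn0Ngt hm mulr0 leNgt c0.
pose P := [set q | dist q != 0].
have fP : finite_set (~` P).
  have [[q0 hq0]|h] := pselect (exists q, dist q = 0).
    apply: sub_finite_set (finite_set1 q0) => q /negP; rewrite negbK => /eqP hq.
    exact: uniq0.
  by rewrite (_ : ~` P = set0)// -subset0 => q /negP; rewrite negbK => /eqP hq; apply: h; exists q.
have hD := inhom_min_not_classD A g P hO fP.
(* [4^n] comes from [2^(k+1) + 2^(k+2) <= 4 2^(k+1)], [2^m] from adding two distances; the cap [1]
   keeps the radius [d] at most [1], as [inhom_min_lt] requires. *)
pose c1 : R := Num.min 1 (c / (2 ^+ m * 4 ^+ n)).
have c10 : 0 < c1 by rewrite lt_min ltr01 divr_gt0 ?mulr_gt0 ?exprn_gt0.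
have c1c : 2 ^+ m * 4 ^+ n * c1 <= c.
  by rewrite mulrC -ler_pdivlMr ?mulr_gt0 ?exprn_gt0// ge_min lexx orbT.
have [K hK] := not_classD_dyadic_small hn _ (inhom_min_ge0 A g P)
  (fun i j ij => inhom_min_mono A g P i j (proj2 (andP ij))) c1 hD c10.
have ex k : (K <= k)%N -> exists q, P q /\ (supnormZ n q <= 2 ^ k.+1)%N /\
    (2 ^ k.+1)%:R ^+ n * dist q ^+ m < c1.
  move=> /hK; set M := (2 ^ k.+1)%N => hM.
  have M0 : 0 < M%:R ^+ n :> R by rewrite exprn_gt0// ltr0n expn_gt0.
  have [d [d0 hd]] := root_exists m (c1 / M%:R ^+ n) hm (divr_gt0 c10 M0).
  have : inhom_min A g P M < d.
    rewrite -(@ltr_pXn2r _ m)// ?nnegrE ?inhom_min_ge0 ?(ltW d0)//.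
    by rewrite hd ltr_pdivlMr// mulrC.
  case/inhom_min_lt.
    rewrite -(@ler_pXn2r _ m)// ?nnegrE ?(ltW d0)// hd expr1n ler_pdivrMr// mul1r.
    apply: (@le_trans _ _ 1); first by rewrite ge_min lexx.
    by rewrite exprn_ege1// ler1n expn_gt0.
  move=> q [Pq qM hq]; exists q; split=> //; split=> //.
  rewrite mulrC -ltr_pdivlMr// -hd ltr_pXn2r// ?nnegrE ?(ltW d0)//.
have {}ex k : exists q, (K <= k)%N -> P q /\ (supnormZ n q <= 2 ^ k.+1)%N /\
    (2 ^ k.+1)%:R ^+ n * dist q ^+ m < c1.
  have [/ex[q hq]|_] := leqP K k; first by exists q.
  by exists 0.
have [f hf] := choice ex.
(* Otherwise the difference of two consecutive near-minimizers would violate the lower bound [c]. *)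
have step k : (K <= k)%N -> f k.+1 = f k.
  move=> Kk; have [_ [fk1 fk2]] := hf k Kk.
  have [_ [fk3 fk4]] := hf k.+1 (leqW Kk).
  apply/eqP; rewrite -subr_eq0; apply/negP => /negP/hc; apply/negP; rewrite -ltNge.
  apply: lt_le_trans c1c.
  have M0 : 0 < (2 ^ k.+1)%:R :> R by rewrite ltr0n expn_gt0.
  have hN : (supnormZ n (f k.+1 - f k) <= 4 * 2 ^ k.+1)%N.
    apply: leq_trans (supnormZB _ _) _; apply: leq_trans (leq_add fk3 fk1) _.
    by rewrite [(2 ^ k.+2)%N]expnS -mulSnr leq_mul2r orbT.
  apply: (@le_lt_trans _ _ ((4 * 2 ^ k.+1)%:R ^+ n * (2 * Num.max (dist (f k)) (dist (f k.+1))) ^+ m)).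
    apply: ler_pM; rewrite ?exprn_ge0 ?distZ_ge0//.
      by rewrite lerXn2r ?nnegrE// ler_nat.
    rewrite lerXn2r ?nnegrE ?distZ_ge0 ?mulr_ge0 ?le_max ?dist_ge0//.
    apply: le_trans (distZ_sub_inhom _ g _ _) _; rewrite -!/(dist _).
    by rewrite mulr2n mulrDl mul1r lerD// le_max lexx ?orbT.
  rewrite natrM !exprMn.
  rewrite [ltLHS](_ : _ = 2 ^+ m * 4 ^+ n *
    ((2 ^ k.+1)%:R ^+ n * Num.max (dist (f k)) (dist (f k.+1)) ^+ m)); last by ring.
  rewrite ltr_pM2l ?mulr_gt0 ?exprn_gt0//.
  have [_|_] := leP (dist (f k)) (dist (f k.+1)); last by [].
  apply: le_lt_trans fk4; rewrite ler_wpM2r ?exprn_ge0//.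
  by rewrite lerXn2r ?nnegrE// ler_nat leq_exp2l.
have const k : f (K + k)%N = f K.
  by elim: k => [|k IH]; rewrite ?addn0// addnS step ?leq_addr.
have [Pf _] := hf K (leqnn K).
(* The minimizer is now one fixed vector, at positive distance since it lies in [P]; at index
   [K + B] the growing factor exceeds [c1 / dist (f K) ^+ m]. *)
have x0 : 0 < dist (f K) ^+ m by rewrite exprn_gt0// lt0r Pf dist_ge0.
have xc : 0 <= c1 / dist (f K) ^+ m by rewrite divr_ge0 ?ltW.
have := archi_boundP xc; set B := Num.bound _ => hB.
have [_ [_ ]] := hf (K + B)%N (leq_addr _ _); rewrite const.
rewrite ltNge => /negP; apply.
rewrite -ler_pdivrMr//; apply: le_trans (ltW hB) _.
rewrite -natrX ler_nat -expnM.
apply: leq_trans (ltnW (ltn_expl B (isT : 1 < 2)%N)) _.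
rewrite leq_exp2l// -[X in (X <= _)%N]muln1; apply: leq_mul => //; lia.
Qed.

End BadlyApproximable.

(** The intervals [[u k - 2 e k, u k + 2 e k]] are nested, and the supremum of their left ends lies
    in all of them. *)
Lemma geometric_limit {R : realType} (u e : nat -> R) :
  (forall k, `|u k.+1 - u k| <= e k) -> (forall k, e k.+1 <= e k / 2) ->
  exists l, forall k, `|l - u k| <= 2 * e k.
Proof.
move=> hu he.
pose a k := u k - 2 * e k; pose b k := u k + 2 * e k.
have a_mono : {homo a : i j / (i <= j)%N >-> i <= j}.
  by apply/nondecreasing_seqP => k; have /ler_normlP[] := hu k; have := he k; rewrite /a; lra.
have b_mono : {homo b : i j / (i <= j)%N >-> j <= i}.
  by apply/nonincreasing_seqP => k; have /ler_normlP[] := hu k; have := he k; rewrite /b; lra.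
have e_ge0 k : 0 <= e k by exact: le_trans (normr_ge0 _) (hu k).
have ab i j : a i <= b j.
  apply: le_trans (a_mono _ _ (leq_maxl i j)) _.
  apply: le_trans (b_mono _ _ (leq_maxr i j)).
  by have := e_ge0 (maxn i j); rewrite /a /b; lra.
exists (sup (range a)) => k.
have h1 : a k <= sup (range a).
  by apply: ub_le_sup; [exists (b 0) => _ [i _ <-]; exact: ab | exists k].
have h2 : sup (range a) <= b k.
  by apply: ge_sup; [exists (a 0); exists 0%N | move=> _ [i _ <-]; exact: ab].
move: h1 h2; move: (sup _) => L; rewrite /a /b ler_norml => h1 h2.
by apply/andP; split; lra.
Qed.

Lemma finite_supnormZ_bounded {n : nat} (S : set 'cV[int]_n) : finite_set S ->
  exists B, forall q, S q -> (supnormZ n q <= B)%N.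
Proof.
move=> /finite_seqP[s ->]; exists (\max_(q <- s) supnormZ n q) => q /= qs.
exact: bigop.leq_bigmax_seq.
Qed.

(** * Matrices that are not badly approximable: construction of a target *)

Section NotBadlyApproximable.
Context {R : realType} {m n : nat} (hm : (0 < m)%N) (hn : (0 < n)%N).
Variable A : 'M[R]_(m, n).
Hypothesis A_cube : unit_cube m n A.
Hypothesis A_not_bad : ~ Bad0 m n A.

Lemma not_Bad0_approx (c : R) (N : nat) : 0 < c -> exists q : 'cV[int]_n,
  (N <= supnormZ n q)%N /\ (supnormZ n q)%:R ^+ n * distZ m (A *m intmx q) ^+ m < c.
Proof.
move=> c0; apply: contrapT => h; apply: A_not_bad; split=> //.
exists c; split=> //; exists N => q Nq; rewrite leNgt; apply/negP => hq.
by apply: h; exists q.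
Qed.

Lemma root_seq_exists : exists rho : nat -> R, forall T, (0 < T)%N ->
  0 < rho T /\ rho T ^+ m = (T%:R ^+ n)^-1.
Proof.
suff /choice[rho h] : forall T, exists d : R,
    (0 < T)%N -> 0 < d /\ d ^+ m = (T%:R ^+ n)^-1 by exists rho.
move=> T.
have [T0|T0] := posnP T; first by exists 0; rewrite T0.
have [|d hd] := root_exists m (T%:R ^+ n : R)^-1 hm; last by exists d.
by rewrite invr_gt0 exprn_gt0// ltr0n.
Qed.

Lemma not_Bad0_Omega : exists g, unit_cube m 1 g /\ Omega m n (A, g).
Proof.
have [rho hrho] := root_seq_exists.
(* [F (k, M)] is a vector [r] with [|r| > M] and an integer vector approximating [A r] within
   [rho(|r|) / 2^k] in each coordinate. *)
have [F hF] : exists F : nat * nat -> 'cV[int]_n * 'cV[int]_m, forall kM,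
    (kM.2 < supnormZ n (F kM).1)%N /\
    forall i, `|(A *m intmx (F kM).1) i ord0 - ((F kM).2 i ord0)%:~R| <
      rho (supnormZ n (F kM).1) / 2 ^+ kM.1.
  suff /choice[F h] : forall kM : nat * nat, exists rp : 'cV[int]_n * 'cV[int]_m,
      (kM.2 < supnormZ n rp.1)%N /\
      forall i, `|(A *m intmx rp.1) i ord0 - (rp.2 i ord0)%:~R| <
        rho (supnormZ n rp.1) / 2 ^+ kM.1 by exists F.
  move=> [k M] /=.
  have c0 : 0 < (2 ^+ k : R)^-1 ^+ m by rewrite exprn_gt0 ?invr_gt0 ?exprn_gt0.
  have [r [Mr hr]] := not_Bad0_approx _ M.+1 c0.
  have r0 : (0 < supnormZ n r)%N by exact: leq_ltn_trans Mr.
  have [rho0 rhoE] := hrho _ r0.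
  have d0 : 0 < rho (supnormZ n r) / 2 ^+ k by rewrite divr_gt0 ?exprn_gt0.
  have : distZ m (A *m intmx r) < rho (supnormZ n r) / 2 ^+ k.
    rewrite -(@ltr_pXn2r _ m)// ?nnegrE ?distZ_ge0 ?(ltW d0)// exprMn rhoE.
    by rewrite mulrC ltr_pdivlMr ?exprn_gt0 ?ltr0n// mulrC.
  by move/(distZ_ltP _ _ d0) => [p hp]; exists (r, p).
(* The state is [(q_k, p_k, r_k)]. Demanding [|r_(k+1)| > 2|q_k| + 2 + |r_k|] makes [|q_k|] strictly
   increasing, gives [|q_(k+1)| <= 2|r_(k+1)|], and makes the errors [E k] at least halve. *)
pose stepf k (s : 'cV[int]_n * 'cV[int]_m * 'cV[int]_n) :=
  let rp := F (k.+1, 2 * supnormZ n s.1.1 + 2 + supnormZ n s.2)%N in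
  (s.1.1 + rp.1, s.1.2 + rp.2, rp.1).
pose s := fix s k := if k is k'.+1 then stepf k' (s k') else (0, 0, 0).
pose q k := (s k).1.1; pose p k := (s k).1.2; pose r k := (s k).2.
pose E k := rho (supnormZ n (r k.+1)) / 2 ^+ k.+1.
have rS k : (2 * supnormZ n (q k) + 2 + supnormZ n (r k) < supnormZ n (r k.+1))%N.
  by have [] := hF (k.+1, 2 * supnormZ n (q k) + 2 + supnormZ n (r k))%N.
have qS k : q k.+1 = q k + r k.+1 by [].
have q_lt k : (supnormZ n (q k) < supnormZ n (q k.+1))%N.
  have := rS k; have := supnormZB (q k.+1) (q k).
  rewrite {1}qS addrAC subrr add0r; lia.
have q_le k : (supnormZ n (q k.+1) <= 2 * supnormZ n (r k.+1))%N.
  by have := rS k; have := supnormZD (q k) (r k.+1); rewrite -qS; lia.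
have q_ge k : (k <= supnormZ n (q k))%N.
  by elim: k => // k IH; apply: leq_ltn_trans (q_lt k).
have r0 k : (0 < supnormZ n (r k.+1))%N by exact: leq_ltn_trans (rS k).
have [l hl] : exists l : 'I_m -> R, forall i k,
    `|l i - ((A *m intmx (q k)) i ord0 - (p k i ord0)%:~R)| <= 2 * E k.
  suff /choice[l h] : forall i, exists l : R, forall k,
      `|l - ((A *m intmx (q k)) i ord0 - (p k i ord0)%:~R)| <= 2 * E k by exists l.
  move=> i; apply: geometric_limit => k.
    have [_ /(_ i)] := hF (k.+1, 2 * supnormZ n (q k) + 2 + supnormZ n (r k))%N.
    move/ltW; congr (`| _ | <= _).
    rewrite qS intmxD mulmxDr [p k.+1](_ : _ = p k +
      (F (k.+1, 2 * supnormZ n (q k) + 2 + supnormZ n (r k))%N).2)//.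
    have addE (V : zmodType) (x y : 'cV[V]_m) : (x + y) i ord0 = x i ord0 + y i ord0.
      by rewrite mxE.
    rewrite !addE intrD.
    by rewrite [r k.+1](_ : _ = (F (k.+1, 2 * supnormZ n (q k) + 2 + supnormZ n (r k))%N).1)//; ring.
  rewrite /E [in leLHS]exprS invfM mulrCA mulrC ler_pM2r// ler_pM2r ?invr_gt0 ?exprn_gt0//.
  have [h1 h2] := hrho _ (r0 k); have [h3 h4] := hrho _ (r0 k.+1).
  rewrite -(@ler_pXn2r _ m)// ?nnegrE ?(ltW h1) ?(ltW h3)// h2 h4.
  rewrite lef_pV2 ?posrE ?exprn_gt0 ?ltr0n// lerXn2r ?nnegrE// ler_nat.
  by have := rS k.+1; lia.
pose g : 'cV[R]_m := \col_i (l i - (Num.floor (l i))%:~R).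
have gE k : distZ m (A *m intmx (q k) - g) <= 2 * E k.
  have E0 : 0 <= E k by have [h _] := hrho _ (r0 k); rewrite divr_ge0 ?(ltW h) ?exprn_ge0.
  apply: (distZ_le _ (\col_i (p k i ord0 + Num.floor (l i)))); first by rewrite mulr_ge0.
  move=> i; have := hl i k; rewrite distrC; congr (`| _ | <= _).
  by rewrite !mxE intrD; ring.
exists g; split.
  move=> i j; rewrite mxE subr_ge0 floor_le; split=> //.
  by rewrite ltrBlDl -[X in _ + X]/(1%:~R) -intrD floorD1_gt.
move=> psi hpsi; split=> //; split.
  move=> i j; rewrite mxE subr_ge0 floor_le; split=> //.
  by rewrite ltrBlDl -[X in _ + X]/(1%:~R) -intrD floorD1_gt.
move/finite_supnormZ_bounded => [B hB]; have [psi0 [psi_mono _]] := hpsi.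
(* Vectors of norm above [B] are not solutions for [psi], hence the shift by [B.+1]. With
   [j = k + B + 1] the product is at most [(2|r_(j+1)|)^n (2 E j)^m]; there [|r|^n rho(|r|)^m = 1],
   which leaves [2^(n+m)] times a power of [1/2]. *)
apply: (geometric_not_classD hn psi psi0 psi_mono
  (fun k => supnormZ n (q (k + B.+1)%N)) (2 ^+ (n + m))) hpsi => k.
  by rewrite addSn q_lt andbT (leq_trans _ (q_ge _))// addnS.
rewrite addSn; set j := (k + B.+1)%N.
have psij : psi (supnormZ n (q j)) <= 2 * E j.
  apply: le_trans (gE j); rewrite leNgt; apply/negP => /(hB (q j)).
  by rewrite leqNgt (leq_trans _ (q_ge _))// /j addnS ltnS leq_addl.
have [h1 h2] := hrho _ (r0 j).
apply: (@le_trans _ _ ((2 * supnormZ n (r j.+1))%:R ^+ n * (2 * E j) ^+ m)).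
  apply: ler_pM; rewrite ?exprn_ge0//.
    by rewrite lerXn2r ?nnegrE// ler_nat.
  by rewrite lerXn2r ?nnegrE// (le_trans _ psij).
rewrite natrM !exprMn h2 exprD.
set T := (_%:R ^+ n in X in X <= _).
have T0 : T != 0 by rewrite expf_neq0// pnatr_eq0 -lt0n.
rewrite [leLHS](_ : _ = 2 ^+ n * 2 ^+ m * (2 ^+ j.+1)^-1 ^+ m); last by field.
rewrite ler_pM2l ?mulr_gt0 ?exprn_gt0// exprVn -exprM lef_pV2 ?posrE ?exprn_gt0//.
rewrite ler_eXn2l ?ltr1n// (leq_trans _ (leq_pmulr _ hm))// /j; lia.
Qed.

End NotBadlyApproximable.

(** * Finite covers by boxes and null sets *)

Section Covers.
Context {R : realType} {p q : nat}.

(** An arbitrary finite index type lets grid points and residues index boxes directly; the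
    enumeration by [nat] in [lebesgue_null] is then done once. *)
Definition box_covered (S : set 'M[R]_(p, q)) (v : R) := exists (I : finType) (a b : I -> 'M[R]_(p, q)),
  [/\ forall x i j, a x i j <= b x i j,
      S `<=` [set M | exists x, box p q (a x) (b x) M] &
      \sum_x \prod_(i < p) \prod_(j < q) (b x i j - a x i j) <= v].

Lemma countable_cover_null (S : set 'M[R]_(p, q)) : (0 < p)%N -> (0 < q)%N ->
  (forall eps : R, 0 < eps -> exists E : nat -> set 'M[R]_(p, q),
    S `<=` \bigcup_k E k /\ forall k, box_covered (E k) (eps / 2 ^+ k.+1)) ->
  lebesgue_null p q S.
Proof.
move=> p0 q0 hS eps eps0; have [E [SE hE]] := hS eps eps0.
have [J hJ] : {J : nat -> {I : finType & ((I -> 'M[R]_(p, q)) * (I -> 'M[R]_(p, q)))%type} &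
    forall k, [/\ forall x i j, (tagged (J k)).1 x i j <= (tagged (J k)).2 x i j,
      E k `<=` [set M | exists x, box p q ((tagged (J k)).1 x) ((tagged (J k)).2 x) M] &
      \sum_x \prod_(i < p) \prod_(j < q)
        ((tagged (J k)).2 x i j - (tagged (J k)).1 x i j) <= eps / 2 ^+ k.+1]}.
  apply: (@choice _ _ (fun k (t : {I : finType & ((I -> 'M[R]_(p, q)) * (I -> 'M[R]_(p, q)))%type}) =>
    [/\ forall x i j, (tagged t).1 x i j <= (tagged t).2 x i j,
      E k `<=` [set M | exists x, box p q ((tagged t).1 x) ((tagged t).2 x) M] &
      \sum_x \prod_(i < p) \prod_(j < q)
        ((tagged t).2 x i j - (tagged t).1 x i j) <= eps / 2 ^+ k.+1])) => k; have [I [a [b h]]] := hE k.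
  by exists (existT (fun I : finType => ((I -> 'M[R]_(p, q)) * (I -> 'M[R]_(p, q)))%type) I (a, b)).
pose I k : finType := tag (J k).
pose a (t : {k : nat & I k}) := (tagged (J (tag t))).1 (tagged t).
pose b (t : {k : nat & I k}) := (tagged (J (tag t))).2 (tagged t).
pose vol (t : {k : nat & I k}) := \prod_(i < p) \prod_(j < q) (b t i j - a t i j).
have ab t i j : a t i j <= b t i j by have [h _ _] := hJ (tag t); exact: h.
have vol0 t : 0 <= vol t.
  by apply: prodr_ge0 => i _; apply: prodr_ge0 => j _; rewrite subr_ge0.
(* Boxes are enumerated through codes of pairs. Numbers that code no box get the point [0], of
   volume [0] because [p] and [q] are positive. *)
exists (fun i => oapp a 0 (pickle_inv i)), (fun i => oapp b 0 (pickle_inv i)).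
split; first by move=> k i j; case: pickle_inv => [t|] /=; [exact: ab | exact: lexx].
split.
  move=> M /SE[k _ /(let: And3 _ h _ := hJ k in h)[x hx]].
  exists (pickle (existT I k x)) => //=.
  by rewrite pickleK_inv.
move=> N.
have volE i : \prod_(i0 < p) \prod_(j < q) (oapp b 0 (pickle_inv i) i0 j -
    oapp a 0 (pickle_inv i) i0 j) = oapp vol 0 (pickle_inv i).
  case: pickle_inv => [t|] //=.
  rewrite (bigD1 (Ordinal p0))//= (bigD1 (Ordinal q0))//=.
  by rewrite !mxE subrr !mul0r.
under eq_bigr do rewrite volE.
(* [K] exceeds every set index met among the first [N] codes; [ind] puts the volume of a box on its
   own code, so exchanging sums counts each box at most once. *)
pose K := \max_(i < N) oapp (fun t => (tag t).+1) 0%N (@pickle_inv {k : nat & I k} i).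
pose ind (t : {k : nat & I k}) (i : nat) := if pickle t == i then vol t else 0.
have ind0 t i : 0 <= ind t i by rewrite /ind; case: ifP.
have step1 (i : 'I_N) : oapp vol 0 (pickle_inv i) <= \sum_(k < K) \sum_(x : I k) ind (existT I k x) i.
  case e: (pickle_inv i) => [[k x]|] /=; last by rewrite sumr_ge0// => *; rewrite sumr_ge0.
  have kK : (k < K)%N.
    by have := @leq_bigmax _ (fun i : 'I_N => oapp (fun t => (tag t).+1) 0%N
      (@pickle_inv {k : nat & I k} i)) i; rewrite e.
  rewrite (bigD1 (Ordinal kK))//= (bigD1 x)//= {1}/ind.
  have := @pickle_invK {k : nat & I k} i; rewrite e /= => ->; rewrite eqxx.
  rewrite -addrA lerDl addr_ge0 ?sumr_ge0// => *; rewrite sumr_ge0//.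
apply: (@le_trans _ _ (\sum_(i < N) \sum_(k < K) \sum_(x : I k) ind (existT I k x) i)).
  exact: ler_sum.
rewrite exchange_big/=.
apply: (@le_trans _ _ (\sum_(k < K) eps / 2 ^+ k.+1)); last first.
  suff -> : \sum_(k < K) eps / 2 ^+ k.+1 = eps - eps / 2 ^+ K.
    by rewrite gerBl divr_ge0 ?exprn_ge0// ltW.
  elim: (K) => [|k IH]; first by rewrite big_ord0 expr0 divr1 subrr.
  by rewrite big_ord_recr/= IH exprS; field; rewrite expf_neq0.
apply: ler_sum => k _; rewrite exchange_big/=.
have [_ _ hk] := hJ k; apply: le_trans hk; apply: ler_sum => x _.
rewrite /ind -big_mkcond/=; set t := existT I (k : nat) x.
have [tN|Nt] := ltnP (pickle t) N.
  by rewrite (big_pred1 (Ordinal tN))// => i; rewrite -val_eqE/= eq_sym.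
rewrite big_pred0; first exact: (vol0 t).
by move=> i; apply/negbTE; rewrite neq_ltn (leq_trans (ltn_ord i) Nt) orbT.
Qed.

End Covers.

(** Let [T = |r|] be attained at coordinate [i0]. Subtracting some [j r] with [|j| <= 2L] brings
    coordinate [i0] of [q] into [[0, T)], keeps the norm at most [3Q], and moves [A q] by less than
    [d] modulo 1. So [T (6Q+1)^n] vectors suffice, with radius [2d]. *)
Lemma box_covered_near_orbit {R : realType} {m n : nat} (A : 'M[R]_(m, n.+1))
    (L : nat) (r : 'cV[int]_n.+1) (d : R) :
  (0 < L)%N -> (0 < supnormZ n.+1 r)%N -> 0 < d <= 1 ->
  (2 * L)%:R * distZ m (A *m intmx r) < d ->
  let Q := (L * supnormZ n.+1 r)%N in
  box_covered [set g | unit_cube m 1 g /\ exists q, (supnormZ n.+1 q <= Q)%N /\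
      distZ m (A *m intmx q - g) < d]
    ((supnormZ n.+1 r * (6 * Q).+1 ^ n * 5 ^ m)%:R * (4 * d) ^+ m).
Proof.
move=> L0 T0 /andP[d0 d1] hd Q; set T := supnormZ n.+1 r in T0 Q *.
have [i0 hi0] := supnormZ_attained r; rewrite -/T in hi0.
pose qv (t : 'I_T * 'cV['I_(6 * Q).+1]_n * 'cV['I_5]_m) : 'cV[int]_n.+1 :=
  \col_j (if unlift i0 j is Some j' then (t.1.2 j' ord0 : nat)%:Z - (3 * Q)%:Z
          else (t.1.1 : nat)%:Z).
(* Fractional parts and the entries of [g] lie in [[0, 1)] and [2d <= 2], so the integer translates
   from [-2] to [2] suffice. *)
pose ctr (t : 'I_T * 'cV['I_(6 * Q).+1]_n * 'cV['I_5]_m) i : R :=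
  (A *m intmx (qv t)) i ord0 - (Num.floor ((A *m intmx (qv t)) i ord0))%:~R
  - ((t.2 i ord0 : nat)%:Z - 2)%:~R.
exists ('I_T * 'cV['I_(6 * Q).+1]_n * 'cV['I_5]_m)%type.
exists (fun t => \col_i (ctr t i - 2 * d)), (fun t => \col_i (ctr t i + 2 * d)).
split.
- by move=> t i j; rewrite !mxE; lra.
- move=> g [g_cube [q [qQ hq]]].
  pose j := (q i0 ord0 %/ r i0 ord0)%Z.
  have ri0 : r i0 ord0 != 0 by rewrite -absz_eq0 -hi0 -lt0n.
  pose q' := q - j *: r.
  have q'i0 : q' i0 ord0 = (q i0 ord0 %% r i0 ord0)%Z.
    by rewrite !mxE {1}(divz_eq (q i0 ord0) (r i0 ord0)) addrAC subrr add0r.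
  have x0 : (0 <= q' i0 ord0) by rewrite q'i0 modz_ge0.
  have xT : (`|q' i0 ord0| < T)%N.
    by rewrite hi0 -ltz_nat gez0_abs// q'i0 abszE ltz_mod.
  have jL : (`|j| <= 2 * L)%N.
    have : (`|(j * r i0 ord0)%R| <= `|q i0 ord0| + `|q' i0 ord0|)%N.
      have -> : j * r i0 ord0 = q i0 ord0 - q' i0 ord0 by rewrite q'i0 /j /modz; ring.
      by rewrite -lez_nat PoszD !abszE; exact: ler_normB.
    rewrite abszM -hi0 => h.
    have h2 : (`|j| * T < (L + 1) * T)%N.
      apply: leq_ltn_trans h _; rewrite mulnDl mul1n.
      by rewrite -addnS leq_add// (leq_trans (supnormZ_ge q i0)).
    by move: h2; rewrite ltn_mul2r => /andP[_]; lia.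
  have q'Q : (supnormZ n.+1 q' <= 3 * Q)%N.
    apply: leq_trans (supnormZB _ _) _.
    have -> : supnormZ n.+1 (j *: r) = (`|j| * T)%N.
      rewrite -supnormZ_scale /supnormZ; apply: eq_bigr => i _.
      by rewrite !mxE !abszM absz_nat.
    rewrite mulSn leq_add// /Q mulnA leq_mul2r jL orbT//.
  have hq' : distZ m (A *m intmx q' - g) < 2 * d.
    have -> : A *m intmx q' - g = (A *m intmx q - g) - A *m intmx (j *: r).
      by rewrite intmxB mulmxBr addrAC.
    apply: le_lt_trans (distZB _ _) _.
    have : distZ m (A *m intmx (j *: r)) <= (2 * L)%:R * distZ m (A *m intmx r).
      apply: le_trans (distZ_mulmx_scale _ _ _) _.
      by rewrite ler_wpM2r ?distZ_ge0// ler_nat.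
    lra.
  have [|p hp] := (distZ_ltP _ (2 * d) _).1 hq'; first lra.
  have {}hp i : `|(A *m intmx q') i ord0 - g i ord0 - (p i ord0)%:~R| < 2 * d.
    by have := hp i; rewrite [(_ - g) i ord0]mxE [(- g) i ord0]mxE.
  pose fl i := Num.floor ((A *m intmx q') i ord0).
  have w_ok i : (`|(p i ord0 - fl i + 2)%R| < 5)%N /\ 0 <= p i ord0 - fl i + 2.
    have := hp i; have [] := g_cube i ord0 => g0 g1.
    have /andP[] := floor_itv ((A *m intmx q') i ord0).
    rewrite -/(fl i) intrD => f1 f2; rewrite ltr_norml => /andP[p1 p2].
    have b1 : (-3)%:~R < (p i ord0 - fl i)%:~R :> R.
      by rewrite intrD !intrN; lra.
    have b2 : (p i ord0 - fl i)%:~R < 3%:~R :> R.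
      by rewrite intrD !intrN; lra.
    by move: b1 b2; rewrite !ltr_int; move: (p i ord0 - fl i) => x; clear; lia.
  have hG j' : (`|(q' (lift i0 j') ord0 + (3 * Q)%:Z)%R| < (6 * Q).+1)%N /\
      0 <= q' (lift i0 j') ord0 + (3 * Q)%:Z.
    by have := leq_trans (supnormZ_ge q' (lift i0 j')) q'Q; move: (q' _ _) (Q) => y z; lia.
  pose t : 'I_T * 'cV['I_(6 * Q).+1]_n * 'cV['I_5]_m :=
    (Ordinal xT, \col_j' Ordinal (proj1 (hG j')), \col_i Ordinal (proj1 (w_ok i))).
  have qvt : qv t = q'.
    apply/matrixP => k z; rewrite ord1 mxE.
    case: unliftP => [j' ->|->] /=; last by rewrite gez0_abs.
    by rewrite mxE /= gez0_abs ?(proj2 (hG j'))// addrK.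
  exists t => i z; rewrite ord1 !mxE /ctr qvt [t.2 _ _]mxE /= gez0_abs ?(proj2 (w_ok i))//.
  have := hp i; rewrite -/(fl i) ltr_norml !(intrD, intrN) => /andP[p1 p2].
  by apply/andP; split; lra.
rewrite (eq_bigr (fun=> (4 * d) ^+ m)); last first.
  move=> t _; rewrite (eq_bigr (fun=> 4 * d)); last first.
    by move=> i _; rewrite big_ord1 !mxE; ring.
  by rewrite prodr_const card_ord.
by rewrite sumr_const !card_prod !card_mx !card_ord !muln1 [leRHS]mulr_natl.
Qed.

(** * Null fibers for a fixed matrix *)

Section NullFibersLow.
Context {R : realType} {m n : nat} (hm : (0 < m)%N).
Variable A : 'M[R]_(m, n.+1).
Hypothesis A_cube : unit_cube m n.+1 A.

Lemma not_Bad0_cover (v : R) (N : nat) : ~ Bad0 m n.+1 A -> 0 < v ->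
  exists (Q : nat) (d : R), [/\ (N <= Q)%N, 0 < d <= 1, 1 <= Q%:R ^+ n.+1 * d ^+ m &
    box_covered [set g | unit_cube m 1 g /\ exists q, (supnormZ n.+1 q <= Q)%N /\
      distZ m (A *m intmx q - g) < d] v].
Proof.
move=> A_not_bad v0.
(* With [d^m = Q^-(n+1)] and [Q = L T], the volume [T (6Q+1)^n 5^m (4d)^m] is at most
   [C T / Q = C / L], so [L] is taken above [C / v]. *)
pose C : R := 7 ^+ n * 20 ^+ m.
have C0 : 0 <= C / v by rewrite divr_ge0 ?mulr_ge0 ?exprn_ge0// ltW.
have := archi_boundP C0; set L := Num.bound _ => hL.
have L0 : (0 < L)%N by rewrite -(ltr0n R); exact: le_lt_trans hL.
have LR0 : 0 < L%:R :> R by rewrite ltr0n.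
have c0 : 0 < ((2 * L)%:R ^+ m * L%:R ^+ n.+1 : R)^-1.
  by rewrite invr_gt0 mulr_gt0 ?exprn_gt0// ltr0n muln_gt0.
have [r [Nr hr]] := not_Bad0_approx A A_cube A_not_bad _ N.+1 c0.
set T := supnormZ n.+1 r in Nr hr.
have T0 : (0 < T)%N by exact: leq_ltn_trans Nr.
have TR0 : 0 < T%:R :> R by rewrite ltr0n.
pose Q := (L * T)%N.
have QR0 : 0 < Q%:R :> R by rewrite ltr0n muln_gt0 L0.
have [|d [d0 hd]] := root_exists m (Q%:R ^+ n.+1 : R)^-1 hm.
  by rewrite invr_gt0 exprn_gt0.
have d1 : d <= 1.
  rewrite -(@ler_pXn2r _ m)// ?nnegrE ?(ltW d0)// hd expr1n invf_le1 ?exprn_gt0//.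
  by rewrite exprn_ege1// ler1n muln_gt0 L0.
exists Q, d; split.
- by rewrite (leq_trans (ltnW Nr))// leq_pmull.
- by rewrite d0.
- by rewrite hd mulfV// expf_neq0// gt_eqF.
have hdr : (2 * L)%:R * distZ m (A *m intmx r) < d.
  rewrite -(@ltr_pXn2r _ m)// ?nnegrE ?mulr_ge0 ?distZ_ge0 ?(ltW d0)//.
  rewrite hd -[ltRHS]mul1r ltr_pdivlMr ?exprn_gt0//.
  move: hr; rewrite -[ltRHS]mul1r ltr_pdivlMr ?mulr_gt0 ?exprn_gt0 ?ltr0n ?muln_gt0 ?L0//.
  apply: le_lt_trans; rewrite le_eqVlt; apply/orP; left; apply/eqP.
  by rewrite [Q%:R]natrM !exprMn; ring.
have d01 : 0 < d <= 1 by rewrite d0.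
have [I [a [b [ab hc hv]]]] := box_covered_near_orbit A L r d L0 T0 d01 hdr.
exists I, a, b; split=> //; apply: le_trans hv _; rewrite -/T -/Q exprMn hd.
apply: (@le_trans _ _ ((T * (7 * Q) ^ n * 5 ^ m)%:R * (4 ^+ m * Q%:R ^- n.+1))).
  rewrite ler_wpM2r ?mulr_ge0 ?invr_ge0 ?exprn_ge0// ler_nat leq_mul2r leq_mul2l.
  suff -> : ((6 * Q).+1 ^ n <= (7 * Q) ^ n)%N by rewrite !orbT.
  have : (0 < Q)%N by rewrite -(ltr0n R).
  by move: (Q); clear; case: (n) => // k z z0; rewrite leq_exp2r//; lia.
rewrite [leLHS](_ : _ = C / L%:R).
  by rewrite ler_pdivrMr// mulrC -ler_pdivrMr// ltW.
rewrite /C (_ : 20 = 5 * 4 :> R); last by ring.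
rewrite !(natrM, natrX) !exprMn !exprS; field.
by rewrite ?mulf_neq0 ?expf_neq0 ?gt_eqF.
Qed.

Lemma box_covered0 (p q : nat) (v : R) : 0 <= v -> box_covered (set0 : set 'M[R]_(p, q)) v.
Proof.
move=> v0; exists 'I_0, (fun=> 0), (fun=> 0); split=> //.
by rewrite big_ord0.
Qed.

Lemma Omega_low_null : lebesgue_null m 1 (Omega_low m n.+1 A).
Proof.
apply: countable_cover_null => // eps eps0.
have v0 k : 0 < eps / 2 ^+ k.+1 by rewrite divr_gt0 ?exprn_gt0.
have [A_bad|A_not_bad] := pselect (Bad0 m n.+1 A).
  exists (fun=> set0); split=> [g /(Bad0_Omega_empty hm (ltn0Sn n) A g A_bad)//|k].
  exact/box_covered0/ltW.
have [F hF] := choice (fun k => let: ex_intro Q (ex_intro d h) :=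
  not_Bad0_cover (eps / 2 ^+ k.+1) k A_not_bad (v0 k) in
  ex_intro (fun Qd : nat * R => [/\ (k <= Qd.1)%N, 0 < Qd.2 <= 1,
    1 <= Qd.1%:R ^+ n.+1 * Qd.2 ^+ m &
    box_covered [set g | unit_cube m 1 g /\ exists q, (supnormZ n.+1 q <= Qd.1)%N /\
      distZ m (A *m intmx q - g) < Qd.2] (eps / 2 ^+ k.+1)]) (Q, d) h).
(* [psi q] is the supremum of the [d_k] with [q <= Q_k]; as [Q_k^(n+1) d_k^m >= 1] and [Q_k >= k],
   it is in [D]. The value [0] keeps the set nonempty. *)
pose vals q := [set x : R | x = 0 \/ exists k, (q <= (F k).1)%N /\ x = (F k).2].
pose psi q := sup (vals q).
have vals1 q : ubound (vals q) 1.
  by move=> _ [->//|[k [_ ->]]]; have [_ /andP[_ h] _ _] := hF k.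
have psi_ge0 q : 0 <= psi q by apply: ub_le_sup; [exists 1; exact: vals1 | left].
have psi_mono i j : (1 <= i <= j)%N -> psi j <= psi i.
  move=> /andP[_ ij]; apply: ge_sup; first by exists 0; left.
  move=> _ [->|[k [jk ->]]]; first exact: psi_ge0.
  by apply: ub_le_sup; [exists 1; exact: vals1 | right; exists k; rewrite (leq_trans ij)].
have psiD : classD m n.+1 psi.
  apply: contrapT => hD.
  have [K hK] := not_classD_small (ltn0Sn n) psi psi_ge0 psi_mono 1 hD ltr01.
  have [KQ /andP[d0 _] h1 _] := hF K.
  have := hK _ KQ; apply/negP; rewrite -leNgt; apply: le_trans h1 _.
  rewrite ler_wpM2l ?exprn_ge0// lerXn2r ?nnegrE ?(ltW d0)//.
  by apply: ub_le_sup; [exists 1; exact: vals1 | right; exists K].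
exists (fun k => [set g | unit_cube m 1 g /\ exists q, (supnormZ n.+1 q <= (F k).1)%N /\
      distZ m (A *m intmx q - g) < (F k).2]); split; last by move=> k; have [] := hF k.
move=> g /(_ psi psiD)[_ [/= g_cube hW]].
(* A single solution suffices: its distance is below some [d_k] with [|q| <= Q_k], which puts [g] in
   the [k]-th set. *)
have [q hq] : exists q : 'cV[int]_n.+1, distZ m (A *m intmx q - g) < psi (supnormZ n.+1 q).
  apply: contrapT => h; apply: hW; rewrite (_ : mkset _ = set0)// -subset0 => q hq.
  by apply: h; exists q.
case: (sup_gt _ hq) => [|x [->|[k [qk ->]]] hx]; first by exists 0; left.
  by move: hx; rewrite ltNge distZ_ge0.
by exists k => //; split=> //; exists q.
Qed.

End NullFibersLow.

(** * Counting matrices on a grid of prime mesh *)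

Section Grid.
Context {R : realType} {m n p : nat}.
Implicit Type a : 'M['I_p]_(m, n).

Definition grid_point a : 'M[R]_(m, n) := \matrix_(i, j) ((a i j : nat)%:R / p%:R).

Lemma grid_point_mulmx a (q : 'cV[int]_n) i :
  (grid_point a *m intmx q) i ord0 = (\sum_j (a i j : nat)%:Z * q j ord0)%:~R / p%:R.
Proof.
rewrite mxE rmorph_sum/= mulr_suml; apply: eq_bigr => j _.
by rewrite !mxE intrM mulrAC.
Qed.

Lemma grid_round (A : 'M[R]_(m, n)) : (0 < p)%N -> unit_cube m n A ->
  exists a, forall i j, grid_point a i j <= A i j <= grid_point a i j + p%:R^-1.
Proof.
move=> p0 hA; have pR : 0 < p%:R :> R by rewrite ltr0n.
pose f i j := Num.floor (A i j * p%:R).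
have hf i j : 0 <= f i j /\ (`|f i j| < p)%N.
  have [A0 A1] := hA i j; have f0 : 0 <= f i j by rewrite floor_ge0 mulr_ge0// ltW.
  split=> //; rewrite -ltz_nat gez0_abs// -(ltr_int R).
  by apply: le_lt_trans (floor_le _) _; rewrite -[ltRHS]mul1r ltr_pM2r.
exists (\matrix_(i, j) Ordinal (proj2 (hf i j))) => i j; rewrite !mxE /=.
have -> : `|f i j|%:R = (f i j)%:~R :> R by rewrite -[in RHS](gez0_abs (proj1 (hf i j))).
have /andP[h1 h2] := floor_itv (A i j * p%:R).
rewrite ler_pdivrMr// h1 -[X in _ + X]mul1r -mulrDl ler_pdivlMr//.
by rewrite -[X in _ + X]/(1%:~R) -intrD ltW.
Qed.

Lemma distZ_perturb (A B : 'M[R]_(m, n)) (g : 'cV[R]_m) (q : 'cV[int]_n) (e : R) : 0 <= e ->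
  (forall i j, `|A i j - B i j| <= e) ->
  distZ m (A *m intmx q - g) <= distZ m (B *m intmx q - g) + (n * supnormZ n q)%:R * e.
Proof.
move=> e0 AB; have -> : A *m intmx q - g = (B *m intmx q - g) + (A - B) *m intmx q.
  by rewrite mulmxBl [RHS]addrC addrA subrK.
apply: le_trans (distZD _ _) _; rewrite lerD2l.
apply: (distZ_le _ 0) => [|i]; first by rewrite mulr_ge0.
rewrite !mxE subr0; apply: le_trans (ler_norm_sum _ _ _) _.
rewrite mulrC natrM mulrCA -[n in n%:R]card_ord mulr_natl -sumr_const.
apply: ler_sum => j _; rewrite normrM ler_pM//; first by rewrite !mxE.
by rewrite mxE -intr_norm -abszE ler_nat; exact: supnormZ_ge.
Qed.

(** Nearness confines each row sum modulo [p] to [N] residues. As [p] is prime and [0 < |q| < p],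
    some entry [q j0] is invertible modulo [p], so these residues and the other columns determine
    column [j0]: at most [p^(m(n-1)) N^m] matrices remain. *)
Lemma card_grid_near (g : 'cV[R]_m) (q : 'cV[int]_n) (d : R) : prime p -> q != 0 ->
  (supnormZ n q < p)%N -> 1 <= p%:R * d ->
  #|[pred a | distZ m (grid_point a *m intmx q - g) < 2 * d]|%:R <= (p ^ (m * n))%:R * (6 * d) ^+ m.
Proof.
move=> p_prime q0 qp pd.
have p0 := prime_gt0 p_prime; have pR : 0 < p%:R :> R by rewrite ltr0n.
have d0 : 0 < d by rewrite -(pmulr_rgt0 _ pR); lra.
have [j0 qj0] : exists j0, q j0 ord0 != 0.
  apply: contrapT => h; move/eqP: q0; apply; apply/matrixP => j z; rewrite ord1 mxE.
  by apply: contrapT => hj; apply: h; exists j; apply/eqP.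
(* [N] offsets cover the integers of a window of length [4pd]; [1 <= pd] gives [N <= 6pd]. *)
pose N := (Num.trunc (4 * (p%:R * d))).+2.
have N1 : 4 * (p%:R * d) + 1 < N%:R :> R.
  by have := truncnS_gt (4 * (p%:R * d)); rewrite /N -[in ltRHS]natr1; lra.
have N2 : N%:R <= 6 * (p%:R * d) :> R.
  have : (Num.trunc (4 * (p%:R * d)))%:R <= 4 * (p%:R * d) by rewrite truncn_le; lra.
  by rewrite /N -!natr1; lra.
pose S a i := \sum_j (a i j : nat)%:Z * q j ord0.
pose fl i := Num.floor (p%:R * g i ord0 - 2 * (p%:R * d)).
have [w hw] : {w : 'M['I_p]_(m, n) -> 'cV['I_N]_m & forall a,
    distZ m (grid_point a *m intmx q - g) < 2 * d ->
    exists z : 'cV[int]_m, forall i, S a i = fl i + (w a i ord0 : nat)%:Z + p%:Z * z i ord0}.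
  apply: (@choice _ _ (fun a (w : 'cV['I_N]_m) => distZ m (grid_point a *m intmx q - g) < 2 * d ->
    exists z : 'cV[int]_m, forall i, S a i = fl i + (w i ord0 : nat)%:Z + p%:Z * z i ord0)) => a.
  have [near|far] := boolP (distZ m (grid_point a *m intmx q - g) < 2 * d); last first.
    by exists (const_mx ord0).
  have [|z hz] := (distZ_ltP _ (2 * d) _).1 near; first by lra.
  have bnd i : 0 <= S a i - p%:Z * z i ord0 - fl i /\
      (`|(S a i - p%:Z * z i ord0 - fl i)%R| < N)%N.
    have := hz i; rewrite [(_ - g) i ord0]mxE [(- g) i ord0]mxE grid_point_mulmx -/(S a i).
    rewrite -(ltr_pM2l pR) -[X in X * `|_|](ger0_norm (ltW pR)) -normrM !mulrBr.
    rewrite [p%:R * (_ / _)]mulrCA mulfV ?gt_eqF// mulr1 ltr_norml => /andP[h1 h2].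
    have /andP[f1 f2] := floor_itv (p%:R * g i ord0 - 2 * (p%:R * d)).
    move: f1 f2; rewrite -/(fl i) intrD => f1 f2.
    have e : (S a i - p%:Z * z i ord0 - fl i)%:~R =
        (S a i)%:~R - p%:R * (z i ord0)%:~R - (fl i)%:~R :> R.
      by rewrite !intrD !intrN intrM.
    have ge0 : 0 <= S a i - p%:Z * z i ord0 - fl i by rewrite -(ler_int R) e; lra.
    split=> //; rewrite -ltz_nat gez0_abs// -(ltr_int R) e -pmulrn; lra.
  exists (\col_i Ordinal (proj2 (bnd i))) => _; exists z => i.
  by rewrite mxE /= gez0_abs ?(proj1 (bnd i))//; ring.
pose F a : 'M['I_p]_(m, n.-1) * 'cV['I_N]_m := (\matrix_(i, j) a i (lift j0 j), w a).
have F_inj : {in [pred a | distZ m (grid_point a *m intmx q - g) < 2 * d] &, injective F}.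
  move=> a a' /hw[z hz] /hw[z' hz'] [eqF eqw].
  have eqa i j : a i (lift j0 j) = a' i (lift j0 j).
    by have /matrixP/(_ i j) := eqF; rewrite !mxE.
  apply/matrixP => i j; case: (unliftP j0 j) => [j' ->//|->].
  have dS : ((a i j0 : nat)%:Z - (a' i j0 : nat)%:Z) * q j0 ord0 =
      p%:Z * (z i ord0 - z' i ord0).
    have : S a i - S a' i = p%:Z * (z i ord0 - z' i ord0).
      by rewrite hz hz' eqw; ring.
    have SD b : S b i = (b i j0 : nat)%:Z * q j0 ord0 +
        \sum_(j | j != j0) (b i j : nat)%:Z * q j ord0 by rewrite /S (bigD1 j0).
    move <-; rewrite !SD [X in _ = _ + X - _](eq_bigr (fun j => (a' i j : nat)%:Z * q j ord0)).
      by ring.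
    by move=> k; case: (unliftP j0 k) => [k' ->|->]; rewrite ?eqxx// eqa.
  have : (p %| `|((a i j0 : nat)%:Z - (a' i j0 : nat)%:Z)%R| * `|q j0 ord0|)%N.
    by rewrite -abszM dS abszM dvdn_mulr.
  rewrite Euclid_dvdM// [X in _ || X]gtnNdvd ?absz_gt0//; last first.
    exact: leq_ltn_trans (supnormZ_ge q j0) qp.
  rewrite orbF => pdvd; apply/val_inj/eqP; apply: contraT => ne.
  have ha := ltn_ord (a i j0); have ha' := ltn_ord (a' i j0).
  move: pdvd; rewrite gtnNdvd//; move: ne ha ha' => /=;
    move: (nat_of_ord _) (nat_of_ord _) => x y; lia.
have := leq_card_in F _ F_inj; rewrite card_prod !card_mx !card_ord muln1 => hcard.
apply: (@le_trans _ _ (p ^ (m * n.-1) * N ^ m)%:R); first by rewrite ler_nat.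
have n0 : (0 < n)%N by exact: leq_ltn_trans (ltn_ord j0).
rewrite -{2}(prednK n0) mulnS expnD !natrM !natrX.
rewrite [leRHS](_ : _ = p%:R ^+ (m * n.-1) * (6 * (p%:R * d)) ^+ m); last first.
  by rewrite !exprMn; ring.
by rewrite ler_pM2l ?exprn_gt0// lerXn2r ?nnegrE//; lra.
Qed.

End Grid.

(** * Null fibers for a fixed target *)

Section NullFibersUp.
Context {R : realType} {m n : nat} (hm : (0 < m)%N).
Variable g : 'cV[R]_m.

(** The radius is [2d] because rounding a matrix to the grid will cost up to [d]. *)
Let near_ball {p : nat} (Q : nat) (d : R) := [pred a : 'M['I_p]_(m, n) |
  `[< exists q, [/\ q != 0, (supnormZ n q <= Q)%N &
    distZ m (grid_point a *m intmx q - g) < 2 * d] >]].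

Lemma card_grid_near_ball (p Q : nat) (d : R) : prime p -> (Q < p)%N -> 1 <= p%:R * d ->
  #|@near_ball p Q d|%:R <= ((2 * Q).+1 ^ n * p ^ (m * n))%:R * (6 * d) ^+ m.
Proof.
move=> p_prime Qp pd.
have d0 : 0 <= d by have := prime_gt0 p_prime; rewrite -(ltr0n R) => p0; rewrite -(pmulr_rge0 _ p0); lra.
pose qv (t : 'cV['I_(2 * Q).+1]_n) : 'cV[int]_n := \col_i ((t i ord0 : nat)%:Z - Q%:Z).
pose near t := [pred a : 'M['I_p]_(m, n) | distZ m (grid_point a *m intmx (qv t) - g) < 2 * d].
pose good t := (qv t != 0) && (supnormZ n (qv t) <= Q)%N.
have : (#|@near_ball p Q d| <= \sum_(t | good t) #|near t|)%N.
  rewrite -sum1_card.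
  under [leqRHS]eq_bigr do rewrite -sum1_card big_mkcond.
  rewrite exchange_big big_mkcond/=; apply: leq_sum => a _.
  case: ifP => // /asboolP[q [q0 qQ hq]].
  have hG i : (`|(q i ord0 + Q%:Z)%R| < (2 * Q).+1)%N /\ 0 <= q i ord0 + Q%:Z.
    by have := leq_trans (supnormZ_ge q i) qQ; move: (q _ _) => y; lia.
  have [t qt] : exists t, qv t = q.
    exists (\col_i Ordinal (proj1 (hG i))); apply/matrixP => i z.
    by rewrite !mxE /= gez0_abs ?(proj2 (hG i))// addrK (ord1 z).
  rewrite (bigD1 t)/=; last by rewrite /good qt q0.
  by rewrite inE qt hq.
rewrite -(ler_nat R) natr_sum => /le_trans; apply.
apply: (@le_trans _ _ (\sum_(t | good t) (p ^ (m * n))%:R * (6 * d) ^+ m)).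
  apply: ler_sum => t /andP[t0 tQ]; apply: card_grid_near => //.
  exact: leq_ltn_trans Qp.
rewrite sumr_const natrM -mulrA -[leLHS]mulr_natl ler_wpM2r//.
  by rewrite mulr_ge0// exprn_ge0// mulr_ge0.
rewrite ler_nat; apply: leq_trans (max_card _) _.
by rewrite card_mx card_ord muln1.
Qed.

(* Markov's inequality on the grid of mesh [1/p]: with [c K] at least [2 M], at least half of the
   first [K] terms of the series are below [c], whereas each term is below [c] only for a
   proportion [O(c)] of the grid points. *)
Lemma sublevel_box_covered (M v : R) : 0 < v ->
  box_covered [set A | unit_cube m n A /\ forall K, \sum_(0 <= k < K)
    (2 ^ k.+1)%:R ^+ n * inhom_min A g [set q | q != 0] (2 ^ k.+1) ^+ m <= M] v.
Proof.
move=> v0; set P := [set q : 'cV[int]_n | q != 0].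
(* [3^n] comes from [2Q + 1 <= 3Q], [6^m] from the count for one [q]; the [2] in [c] pays for
   Markov's inequality. *)
pose C : R := 3 ^+ n * 6 ^+ m.
have C0 : 0 < C by rewrite mulr_gt0 ?exprn_gt0.
pose c : R := Num.min 1 (v / (2 * C)).
have c0 : 0 < c by rewrite lt_min ltr01 divr_gt0 ?mulr_gt0.
have c1 : c <= 1 by rewrite ge_min lexx.
have cv : 2 * C * c <= v by rewrite mulrC -ler_pdivlMr ?mulr_gt0// ge_min lexx orbT.
pose K := (Num.trunc (2 * M / c)).+1.
have K0 : 0 < K%:R :> R by rewrite ltr0n.
have cK : 2 * M <= K%:R * c by rewrite -ler_pdivrMr//; apply/ltW/truncnS_gt.
have [d hd] : {d : nat -> R & forall k, 0 < d k /\ d k ^+ m = c / (2 ^ k.+1)%:R ^+ n}.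
  apply: (@choice _ _ (fun k d => 0 < d /\ d ^+ m = c / (2 ^ k.+1)%:R ^+ n)) => k.
  by apply: root_exists => //; rewrite divr_gt0 ?exprn_gt0// ltr0n expn_gt0.
have d1 k : d k <= 1.
  have [h1 h2] := hd k; rewrite -(@ler_pXn2r _ m)// ?nnegrE ?(ltW h1)// h2 expr1n.
  rewrite ler_pdivrMr ?exprn_gt0 ?ltr0n ?expn_gt0// mul1r (le_trans c1)//.
  by rewrite exprn_ege1// ler1n expn_gt0.
(* One prime serves all [k < K]: [p d_k >= (n+2) 2^(k+1)] gives [2^(k+1) < p], [p d_k >= 1] and a
   rounding error of at most [d_k]. *)
pose B k := Num.bound ((n.+2 * 2 ^ k.+1)%:R / d k).
have [p pB p_prime] := prime_above (\max_(k < K) B k).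
have p0 := prime_gt0 p_prime; have pR : 0 < p%:R :> R by rewrite ltr0n.
have hp k : (k < K)%N -> (n.+2 * 2 ^ k.+1)%:R <= p%:R * d k.
  move=> kK; have [h1 _] := hd k; rewrite -ler_pdivrMr//.
  apply: (@le_trans _ _ (B k)%:R).
    by apply/ltW/archi_boundP; rewrite divr_ge0// ltW.
  rewrite ler_nat; apply: leq_trans (ltnW pB).
  exact: (@leq_bigmax _ (fun k : 'I_K => B k) (Ordinal kK)).
pose G (k : nat) := @near_ball p (2 ^ k.+1) (d k).
have cardG (k : 'I_K) : #|G k|%:R <= C * c * (p ^ (m * n))%:R.
  have [h1 h2] := hd k; have hpk := hp k (ltn_ord k).
  have pd : (2 ^ k.+1)%:R <= p%:R * d k.
    by apply: le_trans hpk; rewrite ler_nat leq_pmull.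
  apply: le_trans (card_grid_near_ball p (2 ^ k.+1) (d k) p_prime _ _) _.
  - rewrite -(ltr_nat R); apply: (@lt_le_trans _ _ (n.+2 * 2 ^ k.+1)%:R).
      by rewrite ltr_nat ltn_Pmull// expn_gt0.
    by apply: le_trans hpk _; rewrite -[leRHS]mulr1 ler_wpM2l.
  - by apply: le_trans pd; rewrite ler1n expn_gt0.
  rewrite exprMn h2.
  apply: (@le_trans _ _ (((3 * 2 ^ k.+1) ^ n * p ^ (m * n))%:R * (6 ^+ m * (c / (2 ^ k.+1)%:R ^+ n)))).
    rewrite ler_wpM2r ?mulr_ge0 ?exprn_ge0 ?invr_ge0 ?(ltW c0)// ler_nat leq_mul2r.
    apply/orP; right; have : (0 < 2 ^ k.+1)%N by rewrite expn_gt0.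
    by move: (2 ^ k.+1)%N => z; clear; case: (n) => // n' h; rewrite leq_exp2r//; lia.
  rewrite natrM natrX natrM exprMn /C le_eqVlt; apply/orP; left; apply/eqP.
  by field; rewrite expf_neq0// pnatr_eq0 -lt0n expn_gt0.
pose H := [pred a : 'M['I_p]_(m, n) | (K <= 2 * #|[pred k : 'I_K | G k a]|)%N].
have cardH : #|H|%:R <= v * (p ^ (m * n))%:R.
  have h : (#|H| * K <= 2 * \sum_(k < K) #|G k|)%N.
    rewrite -sum_nat_const big_distrr/=.
    under [leqRHS]eq_bigr do rewrite -sum1_card big_mkcond big_distrr/=.
    rewrite exchange_big big_mkcond/=; apply: leq_sum => a _; case: ifP => // Ha.
    by rewrite -big_distrr -big_mkcond sum1_card.
  rewrite -(ler_pM2r K0) -natrM; apply: (@le_trans _ _ (2 * \sum_(k < K) #|G k|)%:R).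
    by rewrite ler_nat.
  rewrite natrM natr_sum; apply: (@le_trans _ _ (2 * (K%:R * (C * c * (p ^ (m * n))%:R)))).
    rewrite ler_pM2l// -[K in K%:R]card_ord mulr_natl -sumr_const.
    exact: ler_sum.
  rewrite [leLHS](_ : _ = 2 * C * c * (p ^ (m * n))%:R * K%:R); last by ring.
  by rewrite ler_wpM2r// ler_wpM2r.
exists {a : 'M['I_p]_(m, n) | H a}.
exists (fun a => grid_point (val a)), (fun a => \matrix_(i, j) (grid_point (val a) i j + p%:R^-1)).
split.
- by move=> a i j; rewrite [leRHS]mxE lerDl invr_ge0.
- move=> A [A_cube hA]; have [a ha] := grid_round A p0 A_cube.
  have Ha : H a.
    have [//|] := boolP (H a).
    pose low : pred 'I_K := fun k => G k a.
    rewrite [H a](_ : _ = (K <= 2 * #|low|)%N)// -ltnNge => hG.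
    (* Otherwise a vector within [d k] for [A] would be within [2 d k] for the grid point [a]. *)
    have large k : k \in predC low -> c <= (2 ^ k.+1)%:R ^+ n * inhom_min A g P (2 ^ k.+1) ^+ m.
      rewrite inE leNgt; apply: contra => small; apply/asboolP.
      have M0 : 0 < (2 ^ k.+1)%:R ^+ n :> R by rewrite exprn_gt0// ltr0n expn_gt0.
      have [h1 h2] := hd k.
      have : inhom_min A g P (2 ^ k.+1) < d k.
        rewrite -(@ltr_pXn2r _ m)// ?nnegrE ?inhom_min_ge0 ?(ltW h1)//.
        by rewrite h2 ltr_pdivlMr// mulrC.
      case/inhom_min_lt => // q [q0 qQ hq]; exists q; split=> //.
      have pinv0 : 0 <= p%:R^-1 :> R by rewrite invr_ge0.
      apply: le_lt_trans (distZ_perturb _ A g q _ pinv0 _) _.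
        by move=> i j; have /andP[a1 a2] := ha i j; rewrite ler_norml; apply/andP; split; lra.
      have : (n * supnormZ n q)%:R * p%:R^-1 <= d k; last by lra.
      rewrite ler_pdivrMr// mulrC; apply: le_trans (hp k (ltn_ord k)).
      by rewrite ler_nat leq_mul// leqW.
    have hM := hA K; have : c * #|predC low|%:R <= M.
      apply: le_trans hM; rewrite big_mkord (bigID low)/=.
      apply: ler_wpDl.
        by apply: sumr_ge0 => k _; rewrite mulr_ge0 ?exprn_ge0 ?inhom_min_ge0.
      by rewrite mulr_natr -sumr_const; apply: ler_sum => k; exact: large.
    (* More than half of the terms are at least [c], whence [K c < 2 M], against the choice of
       [K]. *)
    have : (K < 2 * #|predC low|)%N.
      have := cardC low; rewrite card_ord => hC.
      by move: hG hC; move: #|_| #|_| => x y; move: (K) => z; clear; lia.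
    rewrite -(ltr_nat R) natrM -(ltr_pM2r c0) => h1 h2; lra.
  by exists (exist _ a Ha) => i j /=; rewrite [X in _ && (_ <= X)]mxE.
rewrite (eq_bigr (fun=> (p%:R^-1) ^+ (m * n))); last first.
  move=> a _; rewrite (eq_bigr (fun=> p%:R^-1 ^+ n)); last first.
    move=> i _; rewrite (eq_bigr (fun=> p%:R^-1)) ?prodr_const ?card_ord// => j _.
    by rewrite [X in X - _]mxE addrAC subrr add0r.
  by rewrite prodr_const card_ord -exprM mulnC.
rewrite sumr_const card_sig exprVn -[leLHS]mulr_natl -natrX ler_pdivrMr//.
by rewrite ltr0n expn_gt0 p0.
Qed.

End NullFibersUp.

(** Membership in the cube is read off from [W] for one element of [D]; the constant [1] serves. *)
Lemma Omega_unit_cube {R : realType} {m n : nat} (A : 'M[R]_(m, n)) (g : 'cV[R]_m) :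
  (0 < n)%N -> Omega m n (A, g) -> unit_cube m n A.
Proof.
move=> hn hO; have psi0 (k : nat) : 0 <= (fun=> 1 : R) k by [].
have psi_mono i j : (1 <= i <= j)%N -> (fun=> 1 : R) j <= (fun=> 1 : R) i by [].
have [] // : W m n (fun=> 1) (A, g).
apply: hO; apply: contrapT => hD.
have [K hK] := not_classD_small hn _ psi0 psi_mono 1 hD ltr01.
have := hK K.+1 (leqnSn K); apply/negP; rewrite -leNgt expr1n mulr1.
by rewrite exprn_ege1// ler1n.
Qed.

Lemma Omega_up_null {R : realType} {m n : nat} (g : 'cV[R]_m) : (0 < m)%N -> (0 < n)%N ->
  lebesgue_null m n (Omega_up m n g).
Proof.
move=> hm hn; apply: countable_cover_null => // eps eps0.
(* The fiber is exhausted by integer bounds [M] on the condensed sums; [q = 0] is left out because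
   the count concerns nonzero linear forms. *)
exists (fun M => [set A | unit_cube m n A /\ forall K, \sum_(0 <= k < K)
    (2 ^ k.+1)%:R ^+ n * inhom_min A g [set q | q != 0] (2 ^ k.+1) ^+ m <= M%:R]).
split; last by move=> k; apply: sublevel_box_covered => //; rewrite divr_gt0 ?exprn_gt0.
move=> A hA; have fP : finite_set (~` [set q : 'cV[int]_n | q != 0]).
  apply: sub_finite_set (finite_set1 0) => q /negP; rewrite negbK => /eqP ->.
  by [].
have [M hM] := not_classD_dyadic_bounded hn _ (inhom_min_ge0 A g _)
  (fun i j ij => inhom_min_mono A g _ i j (proj2 (andP ij)))
  (inhom_min_not_classD A g _ hA fP).
have M0 : 0 <= M by have := hM 0%N; rewrite big_geq.
exists (Num.bound M) => //; split; first exact: Omega_unit_cube hA.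
by move=> K; apply: le_trans (hM K) _; apply/ltW/archi_boundP.
Qed.

Theorem theorem1p3 (R : realType) (m n : nat) (hm : (0 < m)%N) (hn : (0 < n)%N) :
  (* (i) *)
  (\bigcup_(g in @unit_cube R m 1) Omega_up m n g = unit_cube m n `\` Bad0 m n /\
   forall A : 'M[R]_(m, n), unit_cube m n A ->
     (Omega_low m n A = set0 <-> Bad0 m n A)) /\
  (* (ii) *)
  (forall g : 'cV[R]_m, unit_cube m 1 g -> lebesgue_null m n (Omega_up m n g)) /\
  (* (iii) *)
  (forall A : 'M[R]_(m, n), unit_cube m n A -> lebesgue_null m 1 (Omega_low m n A)).
Proof.
split; last split.
- split.
    apply/seteqP; split=> [A [g _ hA]|A [A_cube /(not_Bad0_Omega hm hn A A_cube)[g [g_cube hg]]]].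
      split; first exact: Omega_unit_cube hA.
      by move=> /(Bad0_Omega_empty hm hn A g).
    by exists g.
  move=> A A_cube; split=> [A_empty|A_bad].
    apply: contrapT => /(not_Bad0_Omega hm hn A A_cube)[g [_ hg]].
    by have : Omega_low m n A g by []; rewrite A_empty.
  by rewrite -subset0 => g /(Bad0_Omega_empty hm hn A g A_bad).
- by move=> g _; exact: Omega_up_null.
- by case: n hn => // n' _ A A_cube; exact: Omega_low_null.
Qed.
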